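(* Let $m,n\in\mathbb N$ be standard and let $\mathcal M_{m\times n}^+(\mathbb E)$ be the class of non-negative $m\times n$ matrices over $\mathbb E$. Let $O$ be the $m\times n$ zero matrix. Then for all $\mathcal A,\mathcal B,\mathcal C\in\mathcal M_{m\times n}^+(\mathbb E)$ and all non-negative $\lambda,\mu\in\mathbb E$: (1) $\mathcal A+\mathcal B\in\mathcal M_{m\times n}^+(\mathbb E)$; (2) $\mathcal A+(\mathcal B+\mathcal C)=(\mathcal A+\mathcal B)+\mathcal C$; (3) $O\in\mathcal M_{m\times n}^+(\mathbb E)$ and $\mathcal A+O=\mathcal A$; (4) $\mathcal A+\mathcal B=\mathcal B+\mathcal A$; (5) $\lambda\mathcal A\in\mathcal M_{m\times n}^+(\mathbb E)$; (6) $\lambda(\mu\mathcal A)=(\lambda\mu)\mathcal A$; (7) $1\mathcal A=\mathcal A$; (8) $\lambda(\mathcal A+\mathcal B)=\lambda\mathcal A+\lambda\mathcal B$; (9) $(\lambda+\mu)\mathcal A=\lambda\mathcal A+\mu\mathcal A$. Moreover, whenever products of non-negative matrices over $\mathbb E$ are well-defined (i.e. the sizes, all standard, are compatible), the multiplication is distributive over addition and associative.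
   Context: We work in nonstandard analysis with external sets (the theory HST of Kanovei and Reeken, extending a bounded form of Nelson's IST), so $\mathbb R$ contains nonstandard numbers. A neutrix is a convex additive subgroup of $\mathbb R$ (possibly an external set). An external number is a set $\alpha=a+A=\{a+x: x\in A\}$ with $a\in\mathbb R$ and $A$ a neutrix; $\mathbb E$ is the class of external numbers, and a real $a$ is identified with $a+\{0\}$. Operations are Minkowski operations: $(a+A)\pm(b+B)=(a\pm b)+(A+B)$, $(a+A)(b+B)=ab+aB+bA+AB$. An external number $\alpha$ is non-negative if there exists $x\in\alpha$ with $0\le x$ (so neutrices are non-negative). A matrix over $\mathbb E$ is non-negative if all its entries are non-negative. Addition, scalar multiplication and multiplication of matrices over $\mathbb E$ are defined by the usual formulas. *)

(* Defs.v *)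
From HB Require Import structures.
From mathcomp Require Import all_boot all_order all_algebra.
From mathcomp Require Import mathcomp_extra boolp classical_sets reals.
From mathcomp Require Import topology normedtype.

Set Implicit Arguments.
Unset Strict Implicit.
Unset Printing Implicit Defensive.

Import Order.TTheory GRing.Theory Num.Theory.
Local Open Scope classical_set_scope.
Local Open Scope ring_scope.

(** First-order formulas with a symbol for every finitary relation over [R],
    over variables named by natural numbers. Relations are sets of finite
    sequences, so that no arity has to be carried around. *)
Inductive formula (R : Type) : Type :=
| Rel of set (seq R) & seq nat
| Bot
| Imp of formula R & formula R
| All of nat & formula R.
Arguments Bot {R}.

(** Truth in a universe [T] where the symbol [P] is interpreted by [I P]. *)
Fixpoint holds (R T : Type) (I : set (seq R) -> set (seq T))
    (e : nat -> T) (f : formula R) : Prop :=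
  match f with
  | Rel P s => I P [seq e i | i <- s]
  | Bot => False
  | Imp f g => holds I e f -> holds I e g
  | All i f => forall x : T, holds I (fun j => if j == i then x else e j) f
  end.

(** The real line of nonstandard analysis. [R] stands for the standard reals,
    the carrier for the line containing also nonstandard numbers, and [star P]
    is the extension to the carrier of the standard relation [P]. An external
    set of reals is an arbitrary [set] of the carrier. [transfer] is stated for
    formulas with standard parameters [e]. *)
Record nonstandardReals (R : realType) := NonstandardReals {
  nsr_sort :> realFieldType;
  std : R -> nsr_sort;
  star : set (seq R) -> set (seq nsr_sort);
  star_eq : forall x y : nsr_sort,
    star [set s | s`_0 = s`_1] [:: x; y] <-> x = y;
  star_le : forall x y : nsr_sort,
    star [set s | s`_0 <= s`_1] [:: x; y] <-> x <= y;
  star_add : forall x y z : nsr_sort,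
    star [set s | s`_0 + s`_1 = s`_2] [:: x; y; z] <-> x + y = z;
  star_mul : forall x y z : nsr_sort,
    star [set s | s`_0 * s`_1 = s`_2] [:: x; y; z] <-> x * y = z;
  transfer : forall (f : formula R) (e : nat -> R),
    holds id e f <-> holds star (std \o e) f;
  nonstandard_ex : exists x : nsr_sort, forall r : R, x <> std r
}.

Section ExternalNumbers.
Variable S : realFieldType.
Implicit Types (A B C : set S) (a b x y z : S).

Definition neutrix A :=
  [/\ A 0, (forall x y, A x -> A y -> A (x - y)) & is_interval A].

Definition is_external (alpha : set S) :=
  exists a A, neutrix A /\ alpha = [set a + x | x in A].

Definition setadd A B : set S := [set x + y | x in A & y in B].
Definition setmul A B : set S := [set x * y | x in A & y in B].

Lemma neutrixN A x : neutrix A -> A x -> A (- x).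
Proof. by case=> A0 AB _ Ax; rewrite -sub0r; exact: AB. Qed.

Lemma neutrixD A x y : neutrix A -> A x -> A y -> A (x + y).
Proof.
by move=> nA Ax Ay; rewrite -[y]opprK; case: (nA) => _ AB _; apply: AB => //;
  exact: neutrixN.
Qed.

Lemma neutrix_norm A x : neutrix A -> A x -> A `|x|.
Proof. by move=> nA Ax; case: (ger0P x) => // _; exact: neutrixN. Qed.

Lemma neutrix_solid A x y : neutrix A -> A y -> `|x| <= `|y| -> A x.
Proof.
move=> nA Ay; rewrite ler_norml => xy; case: (nA) => _ _ iA.
have nyA := neutrix_norm nA Ay.
exact: iA (neutrixN nA nyA) nyA _ xy.
Qed.

Lemma solid_neutrix A : A 0 -> (forall x y, A x -> A y -> A (x - y)) ->
  (forall x y, A y -> `|x| <= `|y| -> A x) -> neutrix A.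
Proof.
move=> A0 AB sA; split=> // x y Ax Ay z /andP[xz zy].
have [z0|/ltW z0] := leP 0 z.
  by apply: sA Ay _; rewrite !ger0_norm //; exact: le_trans zy.
apply: sA Ax _; rewrite !ler0_norm //; first by rewrite lerN2.
exact: le_trans z0.
Qed.

Lemma neutrix0 : neutrix [set 0].
Proof.
apply: solid_neutrix => //= [x y -> ->|x y ->]; first by rewrite subr0.
by rewrite normr0 normr_le0 => /eqP.
Qed.

Lemma notin_neutrix A x y : neutrix A -> ~ A x -> A y -> `|y| <= `|x|.
Proof.
move=> nA nAx Ay; have [//|/ltW xy] := leP `|y| `|x|.
by case: nAx; exact: neutrix_solid xy.
Qed.

Lemma neutrix_total A B : neutrix A -> neutrix B -> A `<=` B \/ B `<=` A.
Proof.
move=> nA nB; have [AB|] := pselect (A `<=` B); first by left.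
move=> /existsNP[x /not_implyP[Ax nBx]]; right=> y By.
exact: neutrix_solid nA Ax (notin_neutrix nB nBx By).
Qed.

Lemma setaddC A B : setadd A B = setadd B A.
Proof.
by apply/seteqP; split=> _ /= [x Ax [y By <-]]; exists y => //; exists x => //;
  rewrite addrC.
Qed.

Lemma setadd_sub A B : neutrix A -> neutrix B -> A `<=` B -> setadd A B = B.
Proof.
move=> nA nB AB; apply/seteqP; split=> [_ /= [x /AB Bx [y By <-]]|y By /=].
  exact: neutrixD.
by exists 0; [case: nA | exists y => //; rewrite add0r].
Qed.

Lemma neutrix_add A B : neutrix A -> neutrix B -> neutrix (setadd A B).
Proof.
move=> nA nB; have [AB|BA] := neutrix_total nA nB.
  by rewrite setadd_sub.
by rewrite setaddC setadd_sub.
Qed.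

Lemma setmul_solid A B z t :
  neutrix A -> neutrix B -> setmul A B t -> `|z| <= `|t| -> setmul A B z.
Proof.
move=> nA nB [x Ax [y By <-]] zxy; exists x => //.
have [x0|x0] := eqVneq x 0.
  exists 0; first by case: nB.
  by move: zxy; rewrite x0 !mul0r normr0 normr_le0 => /eqP ->.
exists (z / x); last by rewrite mulrC divfK.
apply: neutrix_solid nB By _.
by rewrite normf_div ler_pdivrMr ?normr_gt0// mulrC -normrM.
Qed.

Lemma neutrix_mul A B : neutrix A -> neutrix B -> neutrix (setmul A B).
Proof.
move=> nA nB; apply: solid_neutrix => [|s t [x Ax [y By <-]] [u Au [v Bv <-]]|].
- by exists 0; [case: nA|exists 0; [case: nB|rewrite mul0r]].
- wlog ux : x y u v Ax By Au Bv / `|u| <= `|x| => [wh|].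
    have [/(wh x y u v)|/ltW/(wh u v x y)] := leP `|u| `|x|; first exact.
    move=> /(_ Au Bv Ax By) /setmul_solid; apply => //.
    by rewrite distrC.
  apply: (@setmul_solid A B _ (x * (`|y| + `|v|))) => //.
    exists x => //; exists (`|y| + `|v|) => //.
    by apply: neutrixD => //; exact: neutrix_norm.
  rewrite (le_trans (ler_normB _ _))// !normrM.
  rewrite (@ger0_norm _ (`|y| + `|v|)) ?addr_ge0// mulrDr lerD2l.
  by rewrite ler_wpM2r.
- by move=> z t; exact: setmul_solid.
Qed.

Lemma neutrix_scale a B : neutrix B -> neutrix [set a * y | y in B].
Proof.
move=> nB; apply: solid_neutrix => [|_ _ [x Bx <-] [y By <-]|z _ [y By <-] zy].
- by exists 0; [case: nB|rewrite mulr0].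
- by exists (x - y); [case: nB => _ + _; exact|rewrite mulrBr].
- have [a0|a0] := eqVneq a 0.
    exists 0; first by case: nB.
    by move: zy; rewrite a0 !mul0r normr0 normr_le0 => /eqP ->.
  exists (z / a); last by rewrite mulrC divfK.
  apply: neutrix_solid nB By _.
  by rewrite normf_div ler_pdivrMr ?normr_gt0// mulrC -normrM.
Qed.

(** [(a + A) + (b + B) = (a + b) + (A + B)] *)
Lemma setadd_external a b A B :
  setadd [set a + x | x in A] [set b + y | y in B] =
  [set (a + b) + z | z in setadd A B].
Proof.
apply/seteqP; split.
  move=> _ [_ [x Ax <-] [_ [y By <-] <-]].
  by exists (x + y); [exists x => //; exists y | rewrite addrACA].
move=> _ [_ [x Ax [y By <-]] <-].
exists (a + x); first by exists x.
by exists (b + y); [exists y | rewrite addrACA].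
Qed.

(** [(a + A) (b + B) = ab + aB + bA + AB] *)
Lemma setmul_external a b A B : neutrix A -> neutrix B ->
  setmul [set a + x | x in A] [set b + y | y in B] =
  [set a * b + z | z in
    setadd (setadd [set a * y | y in B] [set b * x | x in A]) (setmul A B)].
Proof.
move=> nA nB; apply/seteqP; split.
  move=> _ [_ [x Ax <-] [_ [y By <-] <-]].
  exists (a * y + b * x + x * y); last first.
    by rewrite mulrDl !mulrDr !addrA (mulrC x b).
  exists (a * y + b * x).
    by exists (a * y); [exists y|exists (b * x) => //; exists x].
  by exists (x * y) => //; exists x => //; exists y.
have A0 : A 0 by case: nA.
have B0 : B 0 by case: nB.
have nAB := neutrix_mul nA nB.
have naB := neutrix_scale a nB.
have nbA := neutrix_scale b nA.
move=> _ [_ [_ [_ [y1 By1 <-] [_ [x1 Ax1 <-] <-]] [_ [x2 Ax2 [y2 By2 <-]] <-]] <-].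
set t := _ + x2 * y2.
have [[Aa Bb]|ab] := pselect (A a /\ B b).
  have : setmul A B (a * b + t).
    apply: neutrixD => //; first by exists a => //; exists b.
    apply: neutrixD => //; last by exists x2 => //; exists y2.
    apply: neutrixD => //; first by exists a => //; exists y1.
    by exists x1 => //; exists b => //; rewrite mulrC.
  move=> [u Au [v Bv <-]]; exists u.
    by exists (u - a); [case: nA => _ + _; exact|rewrite addrC subrK].
  exists v => //.
  by exists (v - b); [case: nB => _ + _; exact|rewrite addrC subrK].
have [[y By ty]|[x Ax tx]] : [set a * y | y in B] t \/ [set b * x | x in A] t.
- have ABsub : [set a * y | y in B] (x2 * y2) \/ [set b * x | x in A] (x2 * y2).
    have [Aa|nAa] := pselect (A a).
      have nBb : ~ B b by move=> Bb; apply: ab.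
      right; apply: (@neutrix_solid _ _ (b * x2)) => //; first by exists x2.
      by rewrite !normrM mulrC ler_wpM2r// (notin_neutrix nB nBb).
    left; apply: (@neutrix_solid _ _ (a * y2)) => //; first by exists y2.
    by rewrite !normrM ler_wpM2r// (notin_neutrix nA nAa).
  have aBt : [set a * y | y in B] (a * y1) by exists y1.
  have bAt : [set b * x | x in A] (b * x1) by exists x1.
  have [aB|bA] := neutrix_total naB nbA.
    right; apply: neutrixD => //; first by apply: neutrixD => //; exact: aB.
    by case: ABsub => // /aB.
  left; apply: neutrixD => //; first by apply: neutrixD => //; exact: bA.
  by case: ABsub => // /bA.
- exists a; first by exists 0; rewrite ?addr0.
  exists (b + y); first by exists y.
  by rewrite mulrDr ty.
- exists (a + x); first by exists x.
  exists b; first by exists 0; rewrite ?addr0.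
  by rewrite mulrDl (mulrC x) tx.
Qed.

Record extnum := ExtNum {
  en_set :> set S;
  en_setP : is_external en_set
}.
Implicit Types alpha beta : extnum.

Lemma is_external_real a : is_external [set a].
Proof.
exists a, [set 0]; split; first exact: neutrix0.
by rewrite image_set1 addr0.
Qed.

Definition en_real a : extnum := ExtNum (is_external_real a).

Lemma is_external_add alpha beta : is_external (setadd alpha beta).
Proof.
case: (en_setP alpha) (en_setP beta) => a [A [nA ->]] [b [B [nB ->]]].
exists (a + b), (setadd A B); split; first exact: neutrix_add.
exact: setadd_external.
Qed.

Definition en_add alpha beta : extnum := ExtNum (is_external_add alpha beta).

Lemma is_external_mul alpha beta : is_external (setmul alpha beta).
Proof.
case: (en_setP alpha) (en_setP beta) => a [A [nA ->]] [b [B [nB ->]]].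
eexists (a * b), _; split; last exact: setmul_external.
by do ![apply: neutrix_add | apply: neutrix_scale | apply: neutrix_mul].
Qed.

Definition en_mul alpha beta : extnum := ExtNum (is_external_mul alpha beta).

Definition en_nonneg alpha := exists2 x : S, en_set alpha x & 0 <= x.

Lemma extnumP alpha beta : alpha = beta <-> alpha = beta :> set S.
Proof.
split=> [->//|]; case: alpha beta => [A pA] [B pB] /= AB.
by subst B; congr ExtNum; exact: Prop_irrelevance.
Qed.

(** [extnum] is not a ring (distributivity fails in general), so the matrix
    operations of the library do not apply. *)

Definition emx_zero m n : 'M[extnum]_(m, n) := const_mx (en_real 0).

Definition emx_add m n (A B : 'M[extnum]_(m, n)) : 'M[extnum]_(m, n) :=
  \matrix_(i, j) en_add (A i j) (B i j).

Definition emx_scale m n alpha (A : 'M[extnum]_(m, n)) : 'M[extnum]_(m, n) :=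
  \matrix_(i, j) en_mul alpha (A i j).

Definition emx_mul m n p (A : 'M[extnum]_(m, n)) (B : 'M[extnum]_(n, p)) :
    'M[extnum]_(m, p) :=
  \matrix_(i, k) \big[en_add/en_real 0]_(j < n) en_mul (A i j) (B j k).

Definition emx_nonneg m n (A : 'M[extnum]_(m, n)) :=
  forall i j, en_nonneg (A i j).

End ExternalNumbers.

Arguments emx_zero {S}.

Declare Scope ext_scope.
Delimit Scope ext_scope with X.
Bind Scope ext_scope with extnum.
Arguments en_add {S} (alpha beta)%_X.
Arguments en_mul {S} (alpha beta)%_X.
Arguments en_nonneg {S} alpha%_X.
Arguments emx_add {S m n} (A B)%_X.
Arguments emx_scale {S m n} (alpha A)%_X.
Arguments emx_mul {S m n p} (A B)%_X.
Arguments emx_nonneg {S m n} A%_X.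
Notation "x + y" := (en_add x y) : ext_scope.
Notation "x * y" := (en_mul x y) : ext_scope.
Reserved Notation "A +m B" (at level 50, left associativity).
Notation "A +m B" := (emx_add A B) : ext_scope.
Notation "l *: A" := (emx_scale l A) : ext_scope.
Notation "A *m B" := (emx_mul A B) : ext_scope.

(* Main.v *)
Require Import Defs.
From HB Require Import structures.
From mathcomp Require Import all_boot all_order all_algebra reals.
From mathcomp Require Import boolp classical_sets normedtype.

(** Addition and multiplication of external numbers are Minkowski operations, so
    the identities claimed are immediate elementwise computations except one:
    distributivity [alpha (beta + gamma) = alpha beta + alpha gamma]. There,
    the inclusion from right to left fails in general, because [u * y + v * z]
    with [u], [v] in [alpha] need not be of the form [w * (y' + z')]. It holds
    for non-negative external numbers thanks to a dichotomy: such a number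
    either contains [0], and is then a neutrix, or consists of positive reals.
    - If [alpha] is a neutrix, [u * y + v * z] is absorbed by
      [alpha * (`|y| + `|z|)], which is itself a neutrix.
    - If [beta] is a neutrix and [alpha] is positive, then [u <= 2 v], so that
      [u * y = v * y'] with [y'] in [beta]; likewise for [gamma].
    - If [beta] and [gamma] are positive, [w] is the weighted mean of [u] and
      [v], which lies in [alpha] by convexity.
    This is [setmul_addr]. Non-negative external numbers therefore form a
    commutative semiring [nnext S], and non-negative matrices are exactly the
    images of matrices over [nnext S] under the entrywise inclusion
    [emx_of_nnext], which transports the operations. The theorem is then the
    general theory of matrices over a commutative semiring. *)

Section NonnegativeExternalNumbers.
Local Open Scope classical_set_scope.
Local Open Scope ring_scope.
Import Order.TTheory GRing.Theory Num.Theory.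
Set Implicit Arguments.
Unset Strict Implicit.
Unset Printing Implicit Defensive.

Variable S : realFieldType.
Implicit Types (alpha beta gamma : extnum S) (u v x y z : S).

(** * External numbers as convex cosets *)

(** With convexity ([extnum_interval]), all that is used of the decomposition
    [alpha = a + A]: a coset of a subgroup is closed under [x + y - z]. *)
Lemma extnum_affine alpha x y z :
  en_set alpha x -> en_set alpha y -> en_set alpha z -> en_set alpha (x + y - z).
Proof.
have [a [A [nA ->]]] := en_setP alpha.
move=> [p Ap <-] [q Aq <-] [r Ar <-]; exists (p + q - r).
  by case: (nA) => _ AB _; apply: AB => //; exact: neutrixD.
by rewrite opprD addrACA (addrC a p) addrK -(addrA a) addrCA !addrA.
Qed.

Lemma extnum_interval alpha : is_interval alpha.
Proof.
have [a [A [[_ _ iA] ->]]] := en_setP alpha.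
move=> _ _ [p Ap <-] [q Aq <-] z /andP[pz zq]; exists (z - a).
  by apply: iA Ap Aq _ _; rewrite lerBrDl pz lerBlDl.
by rewrite addrC subrK.
Qed.

(** A coset containing [0] is the subgroup itself. *)
Lemma extnum_neutrix alpha : en_set alpha 0 -> neutrix alpha.
Proof.
move=> a0; split=> // [x y ax ay|]; last exact: extnum_interval.
by rewrite -[x]addr0; exact: extnum_affine.
Qed.

Lemma extnum_neq0 alpha : exists x, en_set alpha x.
Proof.
have [a [A [[A0 _ _] ->]]] := en_setP alpha.
by exists (a + 0), 0.
Qed.

(** A non-positive element and a non-negative one would, by convexity, enclose
    [0]. Together with [extnum_neutrix], this is the dichotomy between neutrices
    and positive numbers. *)
Lemma extnum_gt0 alpha x : en_nonneg alpha -> ~ en_set alpha 0 ->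
  en_set alpha x -> 0 < x.
Proof.
move=> [y ay y0] na0 ax; rewrite ltNge; apply/negP => x0; apply: na0.
by apply: extnum_interval ax ay _ _; rewrite x0.
Qed.

(** The reflection [v + (v - u)] of [u] about [v] stays in [alpha], hence is
    positive: the elements of a positive external number have bounded ratios. *)
Lemma extnum_lt_double alpha u v : en_nonneg alpha -> ~ en_set alpha 0 ->
  en_set alpha u -> en_set alpha v -> u < v + v.
Proof.
move=> pa na0 au av; rewrite -subr_gt0.
exact: extnum_gt0 pa na0 (extnum_affine av av au).
Qed.

(** * Distributivity *)

(** The products of [alpha] by [s := `|y| + `|z|] form a neutrix, which absorbs
    both [u * y] and [v * z] because [`|y|] and [`|z|] are at most [s], and hence
    absorbs their sum. Absolute values are taken so that no cancellation in
    [y + z] can make the second factor too small. *)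
Lemma distr_neutrix_factor alpha (B C : set S) u v y z : en_set alpha 0 ->
  en_set alpha u -> en_set alpha v -> B `|y| -> C `|z| ->
  setmul alpha (setadd B C) (u * y + v * z).
Proof.
move=> a0 au av By Cz; have na := extnum_neutrix a0.
set s := `|y| + `|z|; have s0 : 0 <= s by rewrite addr_ge0.
have ns := neutrix_scale s na.
have sP w x : en_set alpha w -> `|x| <= s -> [set s * p | p in alpha] (w * x).
  move=> aw xs; apply: (neutrix_solid ns (y := s * w)); first by exists w.
  by rewrite !normrM (ger0_norm s0) mulrC ler_wpM2r.
have [w aw <-] : [set s * p | p in alpha] (u * y + v * z).
  by apply: neutrixD => //; apply: sP => //; rewrite ?lerDl ?lerDr.
exists w => //; exists s; last by rewrite mulrC.
by exists `|y| => //; exists `|z|.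
Qed.

(** The factor [v] can be shared: [u * y = v * (u / v * y)], and the new summand
    [u / v * y] stays in the neutrix [beta] since [u / v < 2]. *)
Lemma distr_neutrix_summand alpha beta (C : set S) u v y z :
  en_nonneg alpha -> ~ en_set alpha 0 -> en_set beta 0 ->
  en_set alpha u -> en_set alpha v -> en_set beta y -> C z ->
  setmul alpha (setadd beta C) (u * y + v * z).
Proof.
move=> pa na0 b0 au av By Cz; have nb := extnum_neutrix b0.
have u0 := extnum_gt0 pa na0 au; have v0 := extnum_gt0 pa na0 av.
exists v => //; exists (u * y / v + z).
  exists (u * y / v); last by exists z.
  apply: (neutrix_solid nb (y := y + y)); first exact: neutrixD.
  rewrite mulrAC normrM -mulr2n normrMn -mulr_natl ler_wpM2r//.
  rewrite gtr0_norm ?divr_gt0// ler_pdivrMr// mulr_natl mulr2n.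
  exact/ltW/(extnum_lt_double pa na0 au av).
by rewrite mulrDr mulrC divfK// gt_eqF.
Qed.

(** The second factor is [y + z], and the first is the mean of [u] and [v] with
    the positive weights [y] and [z], so convexity of [alpha] applies. *)
Lemma distr_positive alpha (B C : set S) u v y z :
  en_set alpha u -> en_set alpha v -> B y -> C z -> 0 < y -> 0 < z ->
  setmul alpha (setadd B C) (u * y + v * z).
Proof.
move=> au av By Cz y0 z0; have s0 : 0 < y + z by rewrite addr_gt0.
exists ((u * y + v * z) / (y + z)); last first.
  by exists (y + z); [exists y => //; exists z | rewrite divfK// gt_eqF].
have [uv|/ltW vu] := leP u v.
  apply: extnum_interval au av _ _.
  rewrite ler_pdivlMr// ler_pdivrMr// !mulrDr lerD2l lerD2r.
  by rewrite !ler_wpM2r// ltW.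
apply: extnum_interval av au _ _.
rewrite ler_pdivlMr// ler_pdivrMr// !mulrDr lerD2l lerD2r.
by rewrite !ler_wpM2r// ltW.
Qed.

Lemma setmul_addr alpha beta gamma :
  en_nonneg alpha -> en_nonneg beta -> en_nonneg gamma ->
  setmul alpha (setadd beta gamma) =
  setadd (setmul alpha beta) (setmul alpha gamma).
Proof.
move=> pa pb pg; apply/seteqP; split.
  move=> _ [u au [_ [y By [z Cz <-]] <-]].
  exists (u * y); first by exists u => //; exists y.
  exists (u * z); first by exists u => //; exists z.
  by rewrite mulrDr.
move=> _ [_ [u au [y By <-]] [_ [v av [z Cz <-]] <-]].
have norm_in (delta : extnum S) x : en_nonneg delta -> en_set delta x ->
    en_set delta `|x|.
  move=> pd dx; have [d0|nd0] := pselect (en_set delta 0).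
    exact: neutrix_norm (extnum_neutrix d0) dx.
  by rewrite gtr0_norm//; exact: extnum_gt0 dx.
have [a0|na0] := pselect (en_set alpha 0).
  by apply: distr_neutrix_factor; rewrite //; exact: norm_in.
have [b0|nb0] := pselect (en_set beta 0); first exact: distr_neutrix_summand.
have [g0|ng0] := pselect (en_set gamma 0).
  by rewrite addrC setaddC; exact: distr_neutrix_summand.
by apply: distr_positive => //; [exact: extnum_gt0 By | exact: extnum_gt0 Cz].
Qed.

(** * The semiring of non-negative external numbers *)

(** Bundling the sign condition makes distributivity unconditional, as the
    interface of semirings requires. *)
Record nnext := NNExt { nnext_val : extnum S; nnextP : en_nonneg nnext_val }.

Lemma nnext_val_inj : injective nnext_val.
Proof.
by move=> [a pa] [b pb] /= ab; subst b; congr NNExt; exact: Prop_irrelevance.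
Qed.

Lemma nnext_eqP (a b : nnext) :
  nnext_val a = nnext_val b :> set S -> a = b.
Proof. by move=> ab; apply: nnext_val_inj; apply/extnumP. Qed.

Lemma en_real_nonneg (r : S) : 0 <= r -> en_nonneg (en_real r).
Proof. by exists r. Qed.

Lemma en_add_nonneg alpha beta :
  en_nonneg alpha -> en_nonneg beta -> en_nonneg (en_add alpha beta).
Proof.
move=> [x ax x0] [y By y0]; exists (x + y); last exact: addr_ge0.
by exists x => //; exists y.
Qed.

Lemma en_mul_nonneg alpha beta :
  en_nonneg alpha -> en_nonneg beta -> en_nonneg (en_mul alpha beta).
Proof.
move=> [x ax x0] [y By y0]; exists (x * y); last exact: mulr_ge0.
by exists x => //; exists y.
Qed.

Definition nnext0 := NNExt (en_real_nonneg (lexx 0)).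
Definition nnext1 := NNExt (en_real_nonneg ler01).
Definition nnext_add a b := NNExt (en_add_nonneg (nnextP a) (nnextP b)).
Definition nnext_mul a b := NNExt (en_mul_nonneg (nnextP a) (nnextP b)).

Lemma nnext_addA : associative nnext_add.
Proof.
move=> a b c; apply: nnext_eqP; apply/seteqP; split.
  move=> _ [x ax [_ [y By [z Cz <-]] <-]].
  by exists (x + y); [exists x => //; exists y | exists z => //; rewrite addrA].
move=> _ [_ [x ax [y By <-]] [z Cz <-]].
by exists x => //; exists (y + z); [exists y => //; exists z | rewrite addrA].
Qed.

Lemma nnext_addC : commutative nnext_add.
Proof. by move=> a b; apply: nnext_eqP; exact: setaddC. Qed.

Lemma nnext_add0 : left_id nnext0 nnext_add.
Proof.
move=> a; apply: nnext_eqP; apply/seteqP; split=> [_ [_ -> [x ax <-]]|x ax].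
  by rewrite add0r.
by exists 0 => //; exists x => //; rewrite add0r.
Qed.

Lemma nnext_mulA : associative nnext_mul.
Proof.
move=> a b c; apply: nnext_eqP; apply/seteqP; split.
  move=> _ [x ax [_ [y By [z Cz <-]] <-]].
  by exists (x * y); [exists x => //; exists y | exists z => //; rewrite mulrA].
move=> _ [_ [x ax [y By <-]] [z Cz <-]].
by exists x => //; exists (y * z); [exists y => //; exists z | rewrite mulrA].
Qed.

Lemma nnext_mulC : commutative nnext_mul.
Proof.
move=> a b; apply: nnext_eqP.
by apply/seteqP; split=> _ [x ax [y By <-]]; exists y => //; exists x => //;
  rewrite mulrC.
Qed.

Lemma nnext_mul1 : left_id nnext1 nnext_mul.
Proof.
move=> a; apply: nnext_eqP; apply/seteqP; split=> [_ [_ -> [x ax <-]]|x ax].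
  by rewrite mul1r.
by exists 1 => //; exists x => //; rewrite mul1r.
Qed.

(** [0] annihilates even neutrices: [{0} * alpha] is [{0}], as [alpha] is
    nonempty. *)
Lemma nnext_mul0 : left_zero nnext0 nnext_mul.
Proof.
move=> a; apply: nnext_eqP; apply/seteqP; split=> [_ [_ -> [x ax <-]]|_ ->].
  by rewrite mul0r.
by have [x ax] := extnum_neq0 (nnext_val a); exists 0 => //; exists x => //;
  rewrite mul0r.
Qed.

Lemma nnext_mulDl : left_distributive nnext_mul nnext_add.
Proof.
move=> a b c; rewrite nnext_mulC [nnext_mul a c]nnext_mulC.
rewrite [nnext_mul b c]nnext_mulC; apply: nnext_eqP.
exact: setmul_addr (nnextP c) (nnextP a) (nnextP b).
Qed.

HB.instance Definition _ := gen_eqMixin nnext.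
HB.instance Definition _ := gen_choiceMixin nnext.
HB.instance Definition _ :=
  GRing.isNmodule.Build nnext nnext_addA nnext_addC nnext_add0.
HB.instance Definition _ := GRing.Nmodule_isComPzSemiRing.Build nnext
  nnext_mulA nnext_mulC nnext_mul1 nnext_mulDl nnext_mul0.

(** * Matrices over the semiring *)

Definition emx_of_nnext m n (A : 'M[nnext]_(m, n)) : 'M[extnum S]_(m, n) :=
  map_mx nnext_val A.

Lemma emx_of_nnext_nonneg m n (A : 'M[nnext]_(m, n)) :
  emx_nonneg (emx_of_nnext A).
Proof. by move=> i j; rewrite mxE; exact: nnextP. Qed.

Lemma emx_nonnegP m n (A : 'M[extnum S]_(m, n)) :
  emx_nonneg A -> exists A', A = emx_of_nnext A'.
Proof.
move=> pA; exists (\matrix_(i, j) NNExt (pA i j)).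
by apply/matrixP => i j; rewrite !mxE.
Qed.

Lemma emx_of_nnext0 m n : emx_zero m n = emx_of_nnext 0.
Proof. by apply/matrixP => i j; rewrite !mxE. Qed.

Lemma emx_of_nnextD m n (A B : 'M[nnext]_(m, n)) :
  emx_add (emx_of_nnext A) (emx_of_nnext B) = emx_of_nnext (A + B).
Proof. by apply/matrixP => i j; rewrite !mxE. Qed.

Lemma emx_of_nnextZ m n (a : nnext) (A : 'M[nnext]_(m, n)) :
  emx_scale (nnext_val a) (emx_of_nnext A) = emx_of_nnext (a *: A).
Proof. by apply/matrixP => i j; rewrite !mxE. Qed.

Lemma emx_of_nnextM m n p (A : 'M[nnext]_(m, n)) (B : 'M[nnext]_(n, p)) :
  emx_mul (emx_of_nnext A) (emx_of_nnext B) = emx_of_nnext (A *m B).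
Proof.
apply/matrixP => i k; rewrite !mxE.
rewrite (big_morph nnext_val (op1 := @en_add S) (id1 := en_real 0)) //.
by apply: eq_bigr => j _; rewrite !mxE.
Qed.

End NonnegativeExternalNumbers.

Local Open Scope ext_scope.

Theorem theorem3p12 (R : realType) (S : nonstandardReals R) :
  (forall (m n : nat) (A B C : 'M[extnum S]_(m, n)) (lambda mu : extnum S),
    emx_nonneg A -> emx_nonneg B -> emx_nonneg C ->
    en_nonneg lambda -> en_nonneg mu ->
    emx_nonneg (A +m B) /\
    A +m (B +m C) = (A +m B) +m C /\
    (emx_nonneg (@emx_zero S m n) /\ A +m emx_zero m n = A) /\
    A +m B = B +m A /\
    emx_nonneg (lambda *: A) /\
    lambda *: (mu *: A) = (lambda * mu) *: A /\
    en_real (1 : S)%R *: A = A /\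
    lambda *: (A +m B) = (lambda *: A) +m (lambda *: B) /\
    (lambda + mu) *: A = (lambda *: A) +m (mu *: A)) /\
  (forall (m n p : nat) (A : 'M[extnum S]_(m, n)) (B C : 'M[extnum S]_(n, p)),
    emx_nonneg A -> emx_nonneg B -> emx_nonneg C ->
    A *m (B +m C) = (A *m B) +m (A *m C)) /\
  (forall (m n p : nat) (A B : 'M[extnum S]_(m, n)) (C : 'M[extnum S]_(n, p)),
    emx_nonneg A -> emx_nonneg B -> emx_nonneg C ->
    (A +m B) *m C = (A *m C) +m (B *m C)) /\
  (forall (m n p q : nat) (A : 'M[extnum S]_(m, n)) (B : 'M[extnum S]_(n, p))
      (C : 'M[extnum S]_(p, q)),
    emx_nonneg A -> emx_nonneg B -> emx_nonneg C ->
    A *m (B *m C) = (A *m B) *m C).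
Proof.
split; [|split; [|split]].
- move=> m n _ _ _ lambda mu /emx_nonnegP[A ->] /emx_nonnegP[B ->]
    /emx_nonnegP[C ->] lambda0 mu0.
  pose l := NNExt lambda0; pose k := NNExt mu0.
  (* The scalars are rewritten as values in the semiring, up to conversion, so
     that the transport lemmas apply to the scalings. *)
  rewrite -[lambda]/(nnext_val l) -[mu]/(nnext_val k).
  rewrite -[en_real _]/(nnext_val (1%R : nnext S)).
  rewrite -[(_ * _)%X]/(nnext_val (l * k)%R).
  rewrite -[(nnext_val l + nnext_val k)%X]/(nnext_val (l + k)%R).
  rewrite emx_of_nnext0 !(emx_of_nnextD, emx_of_nnextZ).
  do !split; try exact: emx_of_nnext_nonneg; congr emx_of_nnext.
  + exact: GRing.addrA.
  + exact: GRing.addr0.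
  + exact: GRing.addrC.
  + exact: GRing.scalerA.
  + exact: GRing.scale1r.
  + exact: GRing.scalerDr.
  + exact: GRing.scalerDl.
- move=> m n p _ _ _ /emx_nonnegP[A ->] /emx_nonnegP[B ->] /emx_nonnegP[C ->].
  by rewrite !(emx_of_nnextD, emx_of_nnextM) mulmxDr.
- move=> m n p _ _ _ /emx_nonnegP[A ->] /emx_nonnegP[B ->] /emx_nonnegP[C ->].
  by rewrite !(emx_of_nnextD, emx_of_nnextM) mulmxDl.
- move=> m n p q _ _ _ /emx_nonnegP[A ->] /emx_nonnegP[B ->]
    /emx_nonnegP[C ->].
  by rewrite !emx_of_nnextM mulmxA.
Qed.
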